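(* Let $(\Omega,\leftarrow,\rightarrow,\triangleleft,\triangleright)$ be a nondegenerate extended diassociative semigroup (EDS), with bijections $\varphi_\leftarrow(\alpha,\beta)=(\alpha\leftarrow\beta,\alpha\triangleleft\beta)$ and $\varphi_\rightarrow(\alpha,\beta)=(\alpha\rightarrow\beta,\alpha\triangleright\beta)$ of $\Omega^2$. Define four products $\curvearrowleft,\curvearrowright,\blacktriangleleft,\blacktriangleright$ on $\Omega$ by: for all $\alpha,\beta\in\Omega$, $$\varphi_\leftarrow^{-1}(\alpha,\beta)=(\alpha\curvearrowleft\beta,\alpha\blacktriangleleft\beta),\qquad\varphi_\rightarrow^{-1}(\alpha,\beta)=(\beta\blacktriangleright\alpha,\beta\curvearrowright\alpha).$$ Then, for all $\alpha,\beta,\gamma\in\Omega$: - $(\alpha\curvearrowright\beta)\curvearrowleft\gamma=\alpha\curvearrowright(\beta\curvearrowleft\gamma)$; - $\alpha\blacktriangleleft(\beta\blacktriangleleft\gamma)=(\alpha\blacktriangleleft\beta)\blacktriangleleft\gamma$ and $(\alpha\blacktriangleright\beta)\blacktriangleright\gamma=\alpha\blacktriangleright(\beta\blacktriangleright\gamma)$; - $\alpha\blacktriangleright(\beta\curvearrowleft\gamma)=\alpha\blacktriangleright\beta$ and $(\alpha\curvearrowright\beta)\blacktriangleleft\gamma=\beta\blacktriangleleft\gamma$; - $(\alpha\curvearrowleft(\beta\blacktriangleleft\gamma))\curvearrowleft(\beta\curvearrowleft\gamma)=\alpha\curvearrowleft\beta$ and $(\alpha\curvearrowright\beta)\curvearrowright((\alpha\blacktriangleright\beta)\curvearrowright\gamma)=\beta\curvearrowright\gamma$;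 - $(\alpha\curvearrowleft(\beta\blacktriangleleft\gamma))\blacktriangleleft(\beta\curvearrowleft\gamma)=(\alpha\blacktriangleleft\beta)\curvearrowleft\gamma$ and $(\alpha\curvearrowright\beta)\blacktriangleright((\alpha\blacktriangleright\beta)\curvearrowright\gamma)=\alpha\curvearrowright(\beta\blacktriangleright\gamma)$; - $(\alpha\curvearrowleft(\beta\curvearrowright\gamma))\curvearrowleft(\beta\blacktriangleright\gamma)=\alpha\curvearrowleft\gamma$ and $(\alpha\blacktriangleleft\beta)\curvearrowright((\alpha\curvearrowleft\beta)\curvearrowright\gamma)=\alpha\curvearrowright\gamma$; - $(\alpha\curvearrowleft(\beta\curvearrowright\gamma))\blacktriangleleft(\beta\blacktriangleright\gamma)=\beta\blacktriangleright(\alpha\blacktriangleleft\gamma)$ and $(\alpha\blacktriangleleft\beta)\blacktriangleright((\alpha\curvearrowleft\beta)\curvearrowright\gamma)=(\alpha\blacktriangleright\gamma)\blacktriangleleft\beta$; - $(\alpha\curvearrowleft\beta)\blacktriangleright\gamma=(\alpha\blacktriangleright\gamma)\curvearrowleft\beta$ and $\beta\curvearrowright(\alpha\blacktriangleleft\gamma)=\alpha\blacktriangleleft(\beta\curvearrowright\gamma)$. In particular, $\blacktriangleleft$ and $\blacktriangleright$ are associative.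
   Context: Extended diassociative semigroups. A diassociative semigroup is a set $\Omega$ with maps $\leftarrow,\rightarrow:\Omega\times\Omega\to\Omega$ such that for all $\alpha,\beta,\gamma\in\Omega$: $(\alpha\leftarrow\beta)\leftarrow\gamma=\alpha\leftarrow(\beta\leftarrow\gamma)=\alpha\leftarrow(\beta\rightarrow\gamma)$; $(\alpha\rightarrow\beta)\leftarrow\gamma=\alpha\rightarrow(\beta\leftarrow\gamma)$; $(\alpha\rightarrow\beta)\rightarrow\gamma=(\alpha\leftarrow\beta)\rightarrow\gamma=\alpha\rightarrow(\beta\rightarrow\gamma)$. An extended diassociative semigroup (EDS) is $(\Omega,\leftarrow,\rightarrow,\triangleleft,\triangleright)$ such that $(\Omega,\leftarrow,\rightarrow)$ is a diassociative semigroup and for all $\alpha,\beta,\gamma\in\Omega$: $\alpha\triangleright(\beta\leftarrow\gamma)=\alpha\triangleright\beta$; $(\alpha\rightarrow\beta)\triangleleft\gamma=\beta\triangleleft\gamma$; $(\alpha\triangleleft\beta)\leftarrow((\alpha\leftarrow\beta)\triangleleft\gamma)=\alpha\triangleleft(\beta\leftarrow\gamma)$; $(\alpha\triangleleft\beta)\triangleleft((\alpha\leftarrow\beta)\triangleleft\gamma)=\beta\triangleleft\gamma$; $(\alpha\triangleleft\beta)\rightarrow((\alpha\leftarrow\beta)\triangleleft\gamma)=\alpha\triangleleft(\beta\rightarrow\gamma)$; $(\alpha\triangleleft\beta)\triangleright((\alpha\leftarrow\beta)\triangleleft\gamma)=\beta\triangleright\gamma$; $(\alpha\triangleright(\beta\rightarrow\gamma))\leftarrow(\beta\triangleright\gamma)=(\alpha\leftarrow\beta)\triangleright\gamma$;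 $(\alpha\triangleright(\beta\rightarrow\gamma))\triangleleft(\beta\triangleright\gamma)=\alpha\triangleleft\beta$; $(\alpha\triangleright(\beta\rightarrow\gamma))\rightarrow(\beta\triangleright\gamma)=(\alpha\rightarrow\beta)\triangleright\gamma$; $(\alpha\triangleright(\beta\rightarrow\gamma))\triangleright(\beta\triangleright\gamma)=\alpha\triangleright\beta$. It is nondegenerate if the maps $\varphi_\leftarrow,\varphi_\rightarrow:\Omega^2\to\Omega^2$ given in the claim are bijective. *)

(* Defs.v *)
From mathcomp Require Export ssreflect ssrfun.

Set Implicit Arguments.
Unset Strict Implicit.
Unset Printing Implicit Defensive.

Record is_diassociative (Omega : Type) (l r : Omega -> Omega -> Omega) : Prop :=
  IsDiassociative {
    dia_ll : forall a b c, l (l a b) c = l a (l b c);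
    dia_lr : forall a b c, l a (l b c) = l a (r b c);
    dia_rl : forall a b c, l (r a b) c = r a (l b c);
    dia_rr : forall a b c, r (r a b) c = r (l a b) c;
    dia_lrr : forall a b c, r (l a b) c = r a (r b c)
  }.

(* [l], [r], [tl], [tr] are respectively the products written with a left
   arrow, a right arrow, a left white triangle and a right white triangle. *)
Record is_EDS (Omega : Type) (l r tl tr : Omega -> Omega -> Omega) : Prop :=
  IsEDS {
    eds_dia : is_diassociative l r;
    eds_tr_l : forall a b c, tr a (l b c) = tr a b;
    eds_r_tl : forall a b c, tl (r a b) c = tl b c;
    eds_tl_l : forall a b c, l (tl a b) (tl (l a b) c) = tl a (l b c);
    eds_tl_tl : forall a b c, tl (tl a b) (tl (l a b) c) = tl b c;
    eds_tl_r : forall a b c, r (tl a b) (tl (l a b) c) = tl a (r b c);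
    eds_tl_tr : forall a b c, tr (tl a b) (tl (l a b) c) = tr b c;
    eds_tr_r_l : forall a b c, l (tr a (r b c)) (tr b c) = tr (l a b) c;
    eds_tr_r_tl : forall a b c, tl (tr a (r b c)) (tr b c) = tl a b;
    eds_tr_r_r : forall a b c, r (tr a (r b c)) (tr b c) = tr (r a b) c;
    eds_tr_r_tr : forall a b c, tr (tr a (r b c)) (tr b c) = tr a b
  }.

Definition phi_left (Omega : Type) (l tl : Omega -> Omega -> Omega)
  (p : Omega * Omega) : Omega * Omega := (l p.1 p.2, tl p.1 p.2).

Definition phi_right (Omega : Type) (r tr : Omega -> Omega -> Omega)
  (p : Omega * Omega) : Omega * Omega := (r p.1 p.2, tr p.1 p.2).

Definition nondegenerate (Omega : Type) (l r tl tr : Omega -> Omega -> Omega) :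
  Prop := bijective (phi_left l tl) /\ bijective (phi_right r tr).

Definition inverse_of (A B : Type) (f : A -> B) (g : B -> A) : Prop :=
  cancel f g /\ cancel g f.

(* Main.v *)
(* With F = phi_left, G = phi_right, and F', G' these maps with the two outputs
   exchanged, the axioms say that on Omega^3
     H_23 F_13 F_12 = F_12 H_23        for H = F or G,
     K'_12 G'_13 G'_23 = G'_23 K'_12   for K = F or G,
     F_13 G_12 = G_12 F_23.
   Inverting these equations gives the identities.  The second family is the
   first one for the opposite products. *)
From mathcomp Require Import ssrbool.
Require Import Defs.

Set Implicit Arguments.
Unset Strict Implicit.
Unset Printing Implicit Defensive.

(** Two mutually inverse maps of pairs, in coordinates, so that each law serves as a rewrite
    rule. *)
Record inverse_products (T : Type) (m t p q : T -> T -> T) : Prop :=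
  InverseProducts {
    ip_p : forall a b, p (m a b) (t a b) = a;
    ip_q : forall a b, q (m a b) (t a b) = b;
    ip_m : forall x y, m (p x y) (q x y) = x;
    ip_t : forall x y, t (p x y) (q x y) = y
  }.

(** Conjugation by the swap of factors; it gives access to the opposite products. *)
Lemma inverse_products_flip (T : Type) (m t p q : T -> T -> T) :
  inverse_products m t p q ->
  inverse_products (fun a b => m b a) (fun a b => t b a) q p.
Proof. by case=> Hp Hq Hm Ht; split. Qed.

Lemma inverse_of_products (T : Type) (m t p q : T -> T -> T)
    (g : T * T -> T * T) :
  inverse_of (fun u => (m u.1 u.2, t u.1 u.2)) g ->
  (forall x y, g (x, y) = (p x y, q x y)) ->
  inverse_products m t p q.
Proof.
move=> [fK gK] gE; split=> a b.
- by have := fK (a, b); rewrite gE => -[].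
- by have := fK (a, b); rewrite gE => -[].
- by have := gK (a, b); rewrite gE => -[].
- by have := gK (a, b); rewrite gE => -[].
Qed.

(** With F = [(l, tl)] and H = [(m, t)], the last three hypotheses are the coordinates of H_23 F_13
    F_12 = F_12 H_23, and the conclusions those of the inverted equation. *)
Lemma inverse_pentagon (T : Type) (l tl cl bl m t p q : T -> T -> T) :
  inverse_products l tl cl bl ->
  inverse_products m t p q ->
  (forall a b c, l (l a b) c = l a (m b c)) ->
  (forall a b c, m (tl a b) (tl (l a b) c) = tl a (m b c)) ->
  (forall a b c, t (tl a b) (tl (l a b) c) = t b c) ->
  forall x y z,
  [/\ cl (cl x (q y z)) (p y z) = cl x y,
      bl (cl x (q y z)) (p y z) = p (bl x y) z &
      bl x (q y z) = q (bl x y) z].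
Proof.
move=> L M lm mtl ttl x y z.
(* By surjectivity, [(x, y, z)] is F_12 H_23 of some [(a, b, c)], to which both sides must
   reduce. *)
have [a [u [-> ->]]] : exists a u, x = l a u /\ y = tl a u.
  by exists (cl x y), (bl x y); rewrite (ip_m L) (ip_t L).
have [b [c [-> ->]]] : exists b c, u = m b c /\ z = t b c.
  by exists (p u z), (q u z); rewrite (ip_m M) (ip_t M).
rewrite !(ip_p L) !(ip_q L) (ip_p M) (ip_q M).
(* Rereads the triple as H_23 F_13 F_12 of [(a, b, c)], which the left sides undo factor by
   factor. *)
rewrite -mtl -(ttl a) (ip_p M) (ip_q M) -lm.
by rewrite !(ip_p L) !(ip_q L).
Qed.

(** The same inversion for F_13 G_12 = G_12 F_23; [br] and [cr] take their arguments in the order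
    opposite to the theorem's. *)
Lemma inverse_commutation (T : Type) (l tl cl bl r tr br cr : T -> T -> T) :
  inverse_products l tl cl bl ->
  inverse_products r tr br cr ->
  (forall a b c, l (r a b) c = r a (l b c)) ->
  (forall a b c, tr a (l b c) = tr a b) ->
  (forall a b c, tl (r a b) c = tl b c) ->
  forall x y z,
  [/\ br (cl x z) y = br x y,
      cr (cl x z) y = cl (cr x y) z &
      bl x z = bl (cr x y) z].
Proof.
move=> L M lr trl tlr x y z.
have [a [u [-> ->]]] : exists a u, x = r a u /\ y = tr a u.
  by exists (br x y), (cr x y); rewrite (ip_m M) (ip_t M).
have [b [c [-> ->]]] : exists b c, u = l b c /\ z = tl b c.
  by exists (cl u z), (bl u z); rewrite (ip_m L) (ip_t L).
rewrite !(ip_p M) !(ip_q M) (ip_p L) (ip_q L).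
by rewrite trl -(tlr a) -lr (ip_p L) (ip_q L) (ip_p M) (ip_q M).
Qed.

(* cl, cr : left / right curved arrows;  bl, br : left / right black triangles;
   phil', phir' : the inverses of phi_left and phi_right. *)
Theorem proposition6 :
  forall (Omega : Type) (l r tl tr : Omega -> Omega -> Omega),
  is_EDS l r tl tr ->
  nondegenerate l r tl tr ->
  forall (phil' phir' : Omega * Omega -> Omega * Omega),
  inverse_of (phi_left l tl) phil' ->
  inverse_of (phi_right r tr) phir' ->
  forall (cl cr bl br : Omega -> Omega -> Omega),
  (forall a b : Omega, phil' (a, b) = (cl a b, bl a b)) ->
  (forall a b : Omega, phir' (a, b) = (br b a, cr b a)) ->
  (forall a b c : Omega,
     cl (cr a b) c = cr a (cl b c) /\
     (bl a (bl b c) = bl (bl a b) c /\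
      br (br a b) c = br a (br b c)) /\
     (br a (cl b c) = br a b /\
      bl (cr a b) c = bl b c) /\
     (cl (cl a (bl b c)) (cl b c) = cl a b /\
      cr (cr a b) (cr (br a b) c) = cr b c) /\
     (bl (cl a (bl b c)) (cl b c) = cl (bl a b) c /\
      br (cr a b) (cr (br a b) c) = cr a (br b c)) /\
     (cl (cl a (cr b c)) (br b c) = cl a c /\
      cr (bl a b) (cr (cl a b) c) = cr a c) /\
     (bl (cl a (cr b c)) (br b c) = br b (bl a c) /\
      br (bl a b) (cr (cl a b) c) = bl (br a c) b) /\
     (br (cl a b) c = cl (br a c) b /\
      cr b (bl a c) = bl a (cr b c))) /\
  associative bl /\ associative br.
Proof.
move=> Omega l r tl tr [[ll lr rl rr lrr] trl rtl tll tltl tlr tltr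
  trrl trrtl trrr trrtr] _ phil' phir' invl invr cl cr bl br philE phirE.
have L : inverse_products l tl cl bl := inverse_of_products invl philE.
have R : inverse_products r tr (fun x y => br y x) (fun x y => cr y x) :=
  inverse_of_products invr phirE.
have L' := inverse_products_flip L; have R' := inverse_products_flip R.
have llr a b c : l (l a b) c = l a (r b c) by rewrite ll lr.
have rrr a b c : r (r a b) c = r a (r b c) by rewrite rr lrr.
have PLL := inverse_pentagon L L ll tll tltl.
have PLR := inverse_pentagon L R llr tlr tltr.
(* Opposite products read the triple as [(c, b, a)], which reverses the associativity law, hence
   [esym]. *)
have PRR := inverse_pentagon R' R' (fun a b c => esym (rrr c b a))
  (fun a b c => trrr c b a) (fun a b c => trrtr c b a).
have PRL := inverse_pentagon R' L' (fun a b c => esym (lrr c b a))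
  (fun a b c => trrl c b a) (fun a b c => trrtl c b a).
have C := inverse_commutation L R rl trl rtl.
have blA : associative bl by move=> a b c; have [] := PLL a b c.
have brA : associative br by move=> a b c; have [_ _ /esym] := PRR c b a.
split=> // a b c; rewrite /= in PLR PRR PRL C.
(* [C] gives mixed associativity and the absorption laws; the third pentagon coordinates give
   associativity and the final exchange laws, the first two the rest. *)
have [C1 C2 C3] := C b a c.
have [A1 A2 _] := PLL a b c; have [B1 B2 _] := PLR a c b.
have [D1 D2 _] := PRR c b a; have [E1 E2 _] := PRL c a b.
have [_ _ F] := PRL c a b; have [_ _ G] := PLR a c b.
by do ![split].
Qed.
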